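(* For all $n\ge1$, $f\in C[0,1]$ and $x\in[0,1]$, $$F_nf(x)=Lf(x)+\sum_{k=2}^nx(1-x)J_{k-2}(x)\,\frac{(n-k)!\,(n+k-1)!}{(n-1)!\,n!}\int_0^1\bigl(B_n^2f(t)-Lf(t)\bigr)J_{k-2}(t)\,dt .$$
   Context: $Lf(x):=(1-x)f(0)+xf(1)$. $J_i$ ($i\ge0$) are the Jacobi polynomials on $[0,1]$: $J_i$ has degree $i$ and $\int_0^1J_i(x)J_j(x)\,x(1-x)\,dx=\delta_{ij}$ for $i,j\ge0$. $B_n(f;x)=\sum_{k=0}^n f(k/n)\binom nk x^k(1-x)^{n-k}$ is the Bernstein operator and $B_n^2=B_n\circ B_n$. $\Pi_n$ is the space of polynomials of degree at most $n$. The genuine Beta operator $\bar{\mathbb{B}}_n:C[0,1]\to C[0,1]$ is defined by $\bar{\mathbb{B}}_n(f;0)=f(0)$, $\bar{\mathbb{B}}_n(f;1)=f(1)$, and for $x\in(0,1)$ $$\bar{\mathbb{B}}_n(f;x)=\frac{1}{B(nx,n(1-x))}\int_0^1 t^{nx-1}(1-t)^{n(1-x)-1}f(t)\,dt,$$ where $B(\cdot,\cdot)$ is the Euler Beta function. $\bar{\mathbb{B}}_n$ restricts to a bijection $\Pi_n\to\Pi_n$, with inverse $\bar{\mathbb{B}}_n^{-1}$, and $F_n:=\bar{\mathbb{B}}_n^{-1}\circ B_n:C[0,1]\to\Pi_n$. *)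

(* Defs.v *)
From HB Require Import structures.
From mathcomp Require Export all_boot all_order all_algebra.
From mathcomp Require Export all_classical all_reals all_analysis.
Set Implicit Arguments.
Unset Strict Implicit.
Unset Printing Implicit Defensive.
Import Order.TTheory GRing.Theory Num.Theory.
Import numFieldNormedType.Exports.
Local Open Scope classical_set_scope.
Local Open Scope ring_scope.

(* An element of C[0,1] is represented by a function f : R -> R that is
   continuous within `[0, 1]; its values outside [0,1] play no role. *)

Definition linterp (R : realType) (f : R -> R) (x : R) : R :=
  (1 - x) * f 0 + x * f 1.

Definition bernstein (R : realType) (n : nat) (f : R -> R) : {poly R} :=
  \sum_(k < n.+1)
    (f (k%:R / n%:R) * 'C(n, k)%:R) *: ('X ^+ k * (1 - 'X) ^+ (n - k)).

(* The library's beta_fun only takes natural arguments. *)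
Definition euler_beta (R : realType) (a b : R) : R :=
  \int[@lebesgue_measure R]_(t in `[0, 1])
    (t `^ (a - 1) * (1 - t) `^ (b - 1)).

(* Only meaningful for x in [0,1]. *)
Definition genuine_beta (R : realType) (n : nat) (f : R -> R) (x : R) : R :=
  if x == 0 then f 0
  else if x == 1 then f 1
  else (euler_beta (n%:R * x) (n%:R * (1 - x)))^-1 *
       \int[@lebesgue_measure R]_(t in `[0, 1])
         (t `^ (n%:R * x - 1) * (1 - t) `^ (n%:R * (1 - x) - 1) * f t).

(* Inverse of the restriction of the genuine Beta operator to the polynomials
   of degree at most n: the polynomial p of degree at most n whose image agrees
   with q on [0,1]. The default value 0 is never used when n >= 1 and q has
   degree at most n, the restriction being a bijection. *)
Definition genuine_beta_inv (R : realType) (n : nat) (q : {poly R}) : {poly R} :=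
  xget 0 [set p : {poly R} | (size p <= n.+1)%N /\
    forall x : R, x \in `[0, 1] -> genuine_beta n (horner p) x = q.[x]].

Definition Fop (R : realType) (n : nat) (f : R -> R) : {poly R} :=
  genuine_beta_inv n (bernstein n f).

(* Main.v *)
Require Import Defs.
From HB Require Import structures.
From mathcomp Require Import all_boot all_order all_algebra.
From mathcomp Require Import all_classical all_reals all_analysis.
From mathcomp Require Import measurable_realfun ring lra zify.
Set Implicit Arguments.
Unset Strict Implicit.
Unset Printing Implicit Defensive.
Import Order.TTheory GRing.Theory Num.Theory.
Import numFieldNormedType.Exports.
Local Open Scope classical_set_scope.
Local Open Scope ring_scope.

(* Let U_n be the composite of B_n after the genuine Beta operator. Since F_n f
   is a preimage of B_n f under the latter, B_n^2 f = U_n (F_n f), so it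
   suffices to diagonalise U_n. It fixes affine functions, and on multiples of
   the weight x(1-x) it reads U_n (x(1-x) p) = x(1-x) T p, where T is symmetric
   for the form int p q x(1-x) because its kernel is a sum of products
   t^k (1-t)^(n-k) x^k (1-x)^(n-k). Both B_n and the Beta operator are
   triangular on polynomials filtered by degree (use falling factorials for
   B_n, and t^j |-> (nx)(nx+1)...(nx+j-1) / (n(n+1)...(n+j-1)) for the Beta
   operator), which gives the eigenvalues; symmetry and triangularity together
   force the Jacobi polynomials to be eigenvectors of T. *)

(** * The Beta integral with real exponents *)

(** Exhaust the open interval by compact ones and pass to the limit by monotone convergence, which
    is where nonnegativity enters. This covers integrands that blow up at an endpoint, as Beta
    weights with a parameter below 1 do. *)
Lemma ge0_continuous_FTC2oo (R : realType) (f F : R -> R) (a b la lb : R) :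
  a < b ->
  {in `]a, b[, forall x : R, 0 <= f x} ->
  {in `]a, b[, continuous f} ->
  {in `]a, b[, forall x : R, is_derive x 1 F (f x)} ->
  F x @[x --> a^'+] --> la -> F x @[x --> b^'-] --> lb ->
  (\int[@lebesgue_measure R]_(x in `]a, b[) (f x)%:E = (lb - la)%:E)%E.
Proof.
move=> ab f0 cf dF Fa Fb.
(* The denominator starts at 3 so that already the first interval [E 0] is nondegenerate. *)
pose e (i : nat) : R := (b - a) * (i.+3%:R)^-1.
pose E (i : nat) : set R := `[a + e i, b - e i]%classic.
have e_gt0 i : 0 < e i by rewrite mulr_gt0 ?subr_gt0// invr_gt0.
have e_lt i : a + e i < b - e i.
  have : e i <= (b - a) * 3^-1.
    by rewrite ler_pM2l ?subr_gt0// lef_pV2 ?posrE// ler_nat.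
  by move: (e_gt0 i); lra.
have e_le i j : (i <= j)%N -> e j <= e i.
  by move=> ij; rewrite ler_pM2l ?subr_gt0// lef_pV2 ?posrE// ler_nat !ltnS.
have e_cvg : e @ \oo --> 0.
  rewrite -[X in _ --> X](mulr0 (b - a)); apply: cvgMl_tmp.
  have := @cvg_harmonic R; rewrite -(cvg_shiftn 2).
  by under eq_cvg do rewrite /harmonic/= addn2.
have Esub i x : x \in `[a + e i, b - e i] -> x \in `]a, b[.
  rewrite !in_itv /= => /andP[h1 h2].
  by move: (e_gt0 i) => h3; apply/andP; split; lra.
have UE : \bigcup_i E i = `]a, b[%classic.
  apply/seteqP; split=> x.
    by move=> [i _]; exact: Esub.
  rewrite /= in_itv /= => /andP[ax xb].
  have d0 : 0 < Num.min (x - a) (b - x) by rewrite lt_min !subr_gt0 ax.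
  move/cvgr_lt: (e_cvg) => /(_ _ d0)[N _ HN].
  exists N => //; move: (HN N (leqnn N)).
  rewrite /= lt_min /E /= in_itv /= => /andP[h1 h2].
  by apply/andP; split; lra.
have cvgI : (\int[@lebesgue_measure R]_(x in E i) (f x)%:E @[i --> \oo] -->
    \int[@lebesgue_measure R]_(x in `]a, b[) (f x)%:E)%E.
  rewrite -UE; apply: ge0_nondecreasing_set_cvg_integral.
  - move=> i j ij; rewrite subsetEset => x; rewrite /E /= !in_itv /=.
    by move=> /andP[h1 h2]; move: (e_le _ _ ij) => h3; apply/andP; split; lra.
  - by move=> i; exact: measurable_itv.
  - move=> i; apply/measurable_EFinP.
    apply: subspace_continuous_measurable_fun; first exact: measurable_itv.
    by apply: continuous_in_subspaceT => x; rewrite inE => /Esub; exact: cf.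
  - by move=> i x /Esub xab; rewrite lee_fin f0.
have IE i : (\int[@lebesgue_measure R]_(x in E i) (f x)%:E =
    (F (b - e i) - F (a + e i))%:E)%E.
  have cF : {within `[a + e i, b - e i], continuous F}.
    apply: derivable_within_continuous => x /Esub /dF H.
    exact: (@ex_derive _ _ _ _ _ _ _ H).
  rewrite EFinB; apply: continuous_FTC2 => //.
  - by apply: continuous_in_subspaceT => x; rewrite inE => /Esub; exact: cf.
  - move/continuous_within_itvP: cF => /(_ (e_lt i))[_ h1 h2].
    split=> // x xe.
    have /dF H : x \in `]a, b[ by apply: (Esub i); exact: subset_itv_oo_cc.
    exact: (@ex_derive _ _ _ _ _ _ _ H).
  - move=> x xe.
    have /dF H : x \in `]a, b[ by apply: (Esub i); exact: subset_itv_oo_cc.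
    by rewrite derive1E (@derive_val _ _ _ _ _ _ _ H).
have cvgF : F (b - e i) - F (a + e i) @[i --> \oo] --> lb - la.
  apply: cvgB.
  - move/cvg_at_leftP: Fb; apply; split.
      by move=> i; rewrite ltrBlDr ltrDl.
    by rewrite -[X in _ --> X]subr0; apply: cvgB => //; exact: cvg_cst.
  - move/cvg_at_rightP: Fa; apply; split.
      by move=> i; rewrite ltrDl.
    by rewrite -[X in _ --> X]addr0; apply: cvgD => //; exact: cvg_cst.
suff cvgI' : (\int[@lebesgue_measure R]_(x in E i) (f x)%:E @[i --> \oo] -->
    (lb - la)%:E)%E by apply: (cvg_unique _ cvgI cvgI').
under eq_cvg do rewrite IE.
by apply: cvg_EFin => //; exact: nearW.
Qed.

(** * The Beta weight: bounds, derivatives and endpoint limits *)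

Section beta_weight.
Variable R : realType.
Implicit Types a b t : R.
Local Notation mu := (@lebesgue_measure R).

Lemma one_powR a : 1 `^ a = 1 :> R.
Proof. by rewrite powR1. Qed.

Definition beta_weight a b t : R := t `^ (a - 1) * (1 - t) `^ (b - 1).

Lemma measurable_beta_weight a b (D : set R) : measurable_fun D (beta_weight a b).
Proof.
apply: (measurable_funS measurableT) => //; apply: measurable_funM.
  exact: measurable_powR.
apply: (measurableT_comp (measurable_powR (b - 1))).
by apply: measurable_funB => //; exact: measurable_cst.
Qed.

Lemma beta_weight_ge0 a b t : 0 <= beta_weight a b t.
Proof. by rewrite mulr_ge0 ?powR_ge0. Qed.

Lemma beta_weightSl a b t : 0 < a -> 0 <= t ->
  beta_weight (a + 1) b t = beta_weight a b t * t.
Proof.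
move=> a0 t0; rewrite /beta_weight addrK -(mulr_powRB1 t0 a0); ring.
Qed.

Lemma beta_weightSr a b t : 0 < b -> t <= 1 ->
  beta_weight a (b + 1) t = beta_weight a b t * (1 - t).
Proof.
move=> b0 t1; rewrite /beta_weight addrK -(mulr_powRB1 _ b0) ?subr_ge0//; ring.
Qed.

(** An integrable bound for the weight with an elementary primitive, t^a/a - (1-t)^b/b, which the
    weight lacks for general real parameters. *)
Definition beta_majorant a b t : R := t `^ (a - 1) + (1 - t) `^ (b - 1).

(* w = t w + (1 - t) w, where t w = t^a (1-t)^(b-1) and t^a <= 1. *)
Lemma beta_weight_le a b t : 0 < a -> 0 < b -> 0 <= t <= 1 ->
  beta_weight a b t <= beta_majorant a b t.
Proof.
move=> a0 b0 /andP[t0 t1].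
have p1 : t `^ a <= 1.
  by rewrite -[leRHS](one_powR a) ge0_ler_powR ?nnegrE// ltW.
have p2 : (1 - t) `^ b <= 1.
  by rewrite -[leRHS](one_powR b); apply: ge0_ler_powR; rewrite ?nnegrE; lra.
have := beta_weightSl b a0 t0; have := beta_weightSr a b0 t1.
rewrite /beta_weight /beta_majorant !addrK.
have := powR_ge0 t (a - 1); have := powR_ge0 (1 - t) (b - 1).
nra.
Qed.

Lemma is_derive_powR_onem b t : t < 1 ->
  is_derive t 1 (fun x : R => (1 - x) `^ b) (- (b * (1 - t) `^ (b - 1))).
Proof.
move=> t1.
have d : is_derive t (1 : R) (fun x : R => 1 - x) (-1).
  by apply: is_derive_eq; rewrite add0r mul1r.
have p : is_derive (1 - t) (1 : R) (@powR R ^~ b) (b * (1 - t) `^ (b - 1)).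
  by apply: is_derive1_powR; rewrite subr_gt0.
have := is_derive1_comp (f := @powR R ^~ b) (g := fun x : R => 1 - x) p d.
by rewrite mulrN1.
Qed.

Lemma continuous_itv01 (f df : R -> R) :
  (forall t, 0 < t < 1 -> is_derive t (1 : R) f (df t)) ->
  {in `]0, 1[, continuous f}.
Proof.
move=> dF t; rewrite in_itv => /dF H.
apply: differentiable_continuous; apply/derivable1_diffP.
exact: (@ex_derive _ _ _ _ _ _ _ H).
Qed.

Lemma continuous_powR01 a : {in `]0, 1[, continuous (fun t : R => t `^ a)}.
Proof.
apply: continuous_itv01 => t /andP[t0 _]; exact: is_derive1_powR.
Qed.

Lemma continuous_powR_onem01 b :
  {in `]0, 1[, continuous (fun t : R => (1 - t) `^ b)}.
Proof.
apply: continuous_itv01 => t /andP[_ t1]; exact: is_derive_powR_onem.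
Qed.

Lemma powR_cvg_left1 a : t `^ a @[t --> (1 : R)^'-] --> (1 : R).
Proof.
have := @ex_derive _ _ _ _ _ _ _ (is_derive1_powR a (@ltr01 R)).
move=> /derivable1_diffP/differentiable_continuous/cvg_at_left_filter.
by rewrite one_powR.
Qed.

Lemma powR_onem_cvg_right0 b : (1 - t) `^ b @[t --> (0 : R)^'+] --> (1 : R).
Proof.
have := @ex_derive _ _ _ _ _ _ _ (is_derive_powR_onem b (@ltr01 R)).
move=> /derivable1_diffP/differentiable_continuous/cvg_at_right_filter.
by rewrite subr0 one_powR.
Qed.

(** The reflection t -> 1-t carries sequences tending to 1 from the left to sequences tending to 0
    from the right. *)
Lemma powR_onem_cvg_left1 b : 0 < b -> (1 - t) `^ b @[t --> (1 : R)^'-] --> (0 : R).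
Proof.
move=> b0; have /cvg_at_rightP H := powR_cvg0 b0.
apply/cvg_at_leftP => u [u1 ucvg].
apply: (H (fun n => 1 - u n)); split=> [i|]; first by rewrite subr_gt0.
by rewrite -[X in _ --> X](subrr (1 : R)); apply: cvgB => //; exact: cvg_cst.
Qed.
End beta_weight.

Lemma integrable_EFinZl (d : measure_display) (T : measurableType d)
    (R : realType) (mu : {measure set T -> \bar R}) (D : set T) (k : R)
    (f : T -> R) : measurable D -> mu.-integrable D (EFin \o f) ->
  mu.-integrable D (EFin \o (fun t => k * f t)).
Proof.
move=> mD /(integrableZl mD k); apply: eq_integrable => //.
Qed.

(** * Integrability of the weight and the recurrence of the Euler Beta function *)

Section euler_beta.
Variable R : realType.
Implicit Types a b t : R.
Local Notation mu := (@lebesgue_measure R).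
Local Notation I01 := (`[(0 : R)%R, (1 : R)%R]%classic).

Lemma integral_oo01_itv (f : R -> R) : measurable_fun I01 f ->
  (\int[mu]_(t in `](0 : R)%R, (1 : R)%R[) (f t)%:E =
   \int[mu]_(t in I01) (f t)%:E)%E.
Proof.
move=> mf; rewrite -(@integral_itv_bndoo _ _ _ _ true false)//.
apply/measurable_EFinP; apply: measurable_funS mf; first exact: measurable_itv.
exact: subset_itv_oo_cc.
Qed.

Let mI : measurable (I01 : set (measurableTypeR R)).
Proof. exact: measurable_itv. Qed.

Let primitive a b t := t `^ a / a - (1 - t) `^ b / b.

Let is_derive_primitive a b t : 0 < a -> 0 < b -> t \in `]0, 1[ ->
  is_derive t 1 (primitive a b) (beta_majorant a b t).
Proof.
rewrite in_itv => a0 b0 /= /andP[t0 t1].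
have d1 := is_derive1_powR a t0; have d2 := is_derive_powR_onem b t1.
rewrite /primitive; apply: is_derive_eq.
rewrite /beta_majorant !scaler0 !add0r /GRing.scale /=.
by field; rewrite !gt_eqF.
Qed.

Let primitive0 a b : 0 < a -> primitive a b t @[t --> (0 : R)^'+] --> - b^-1.
Proof.
move=> a0; have -> : - b^-1 = 0 * a^-1 - 1 * b^-1 by rewrite mul0r mul1r sub0r.
apply: cvgB; apply: cvgM; try exact: cvg_cst.
- exact: powR_cvg0.
- exact: powR_onem_cvg_right0.
Qed.

Let primitive1 a b : 0 < b -> primitive a b t @[t --> (1 : R)^'-] --> a^-1.
Proof.
move=> b0; have -> : a^-1 = 1 * a^-1 - 0 * b^-1 by rewrite mul0r mul1r subr0.
apply: cvgB; apply: cvgM; try exact: cvg_cst.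
- exact: powR_cvg_left1.
- exact: powR_onem_cvg_left1.
Qed.

Lemma continuous_beta_majorant a b : {in `]0, 1[, continuous (beta_majorant a b)}.
Proof.
move=> t t01; apply: cvgD; first exact: continuous_powR01.
exact: continuous_powR_onem01.
Qed.

Lemma continuous_beta_weight a b : {in `]0, 1[, continuous (beta_weight a b)}.
Proof.
move=> t t01; apply: cvgM; first exact: continuous_powR01.
exact: continuous_powR_onem01.
Qed.

Lemma measurable_beta_majorant a b (D : set R) :
  measurable_fun D (beta_majorant a b).
Proof.
apply: (measurable_funS measurableT) => //; apply: measurable_funD.
  exact: measurable_powR.
apply: (measurableT_comp (measurable_powR (b - 1))).
by apply: measurable_funB => //; exact: measurable_cst.
Qed.

Lemma integral_beta_majorant a b : 0 < a -> 0 < b ->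
  (\int[mu]_(t in I01) (beta_majorant a b t)%:E = (a^-1 + b^-1)%:E)%E.
Proof.
move=> a0 b0; rewrite -integral_oo01_itv; last exact: measurable_beta_majorant.
rewrite -[b^-1]opprK; apply: (ge0_continuous_FTC2oo (F := primitive a b)) => //.
- by move=> t _; rewrite addr_ge0 ?powR_ge0.
- exact: continuous_beta_majorant.
- by move=> t; exact: is_derive_primitive.
- exact: primitive0.
- exact: primitive1.
Qed.

Lemma integrable_beta_majorant a b : 0 < a -> 0 < b ->
  mu.-integrable I01 (EFin \o beta_majorant a b).
Proof.
move=> a0 b0; apply/integrableP; split.
  by apply/measurable_EFinP; exact: measurable_beta_majorant.
under eq_integral => t _.
  rewrite /= ger0_norm; last by rewrite addr_ge0 ?powR_ge0.
  over.
by rewrite integral_beta_majorant// ltry.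
Qed.

Lemma integrable_beta_weight a b : 0 < a -> 0 < b ->
  mu.-integrable I01 (EFin \o beta_weight a b).
Proof.
move=> a0 b0; apply: (le_integrable _ _ _ (integrable_beta_majorant a0 b0)) => //.
  by apply/measurable_EFinP; exact: measurable_beta_weight.
move=> t; rewrite /= in_itv => t01.
rewrite lee_fin !ger0_norm ?beta_weight_ge0//; last by rewrite addr_ge0 ?powR_ge0.
exact: beta_weight_le.
Qed.

(** The derivative of t^a (1-t)^b is a w - (a+b) t w, with w the weight, and t^a (1-t)^b vanishes at
    both ends, so this derivative [f] has integral 0. Since [f] changes sign, a multiple of the
    majorant is added before integrating over the open interval, and its known integral is cancelled
    at the end. *)
Lemma euler_betaS a b : 0 < a -> 0 < b ->
  (a + b) * euler_beta (a + 1) b = a * euler_beta a b.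
Proof.
move=> a0 b0; set c := a + b.
have c0 : 0 < c by rewrite addr_gt0.
pose f t := a * beta_weight a b t - c * (beta_weight a b t * t).
pose g t := f t + c * beta_majorant a b t.
have mf : measurable_fun I01 f.
  have mw : measurable_fun I01 (beta_weight a b) by exact: measurable_beta_weight.
  apply: measurable_funB; apply: measurable_funM; try exact: measurable_cst.
    by [].
  by apply: measurable_funM.
have Ig : (\int[mu]_(t in I01) (g t)%:E = (c * (a^-1 + b^-1))%:E)%E.
  rewrite -integral_oo01_itv; last first.
    apply: measurable_funD => //; apply: measurable_funM.
      exact: measurable_cst.
    exact: measurable_beta_majorant.
  have -> : c * (a^-1 + b^-1) = (0 + c * a^-1) - (0 + c * - b^-1) by ring.
  apply: (ge0_continuous_FTC2oo (F := fun t => t `^ a * (1 - t) `^ b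
      + c * primitive a b t)) => //.
  - move=> t; rewrite in_itv /= => /andP[/ltW t0 /ltW t1].
    have := @beta_weight_le _ a b t a0 b0; rewrite t0 t1 => /(_ isT).
    have := beta_weight_ge0 a b t; rewrite /g /f.
    set w := beta_weight a b t; set m := beta_majorant a b t => w0 wm.
    (* This grouping shows nonnegativity: the weight is below its majorant and t is at most 1. *)
    have -> : a * w - c * (w * t) + c * m = a * w + c * ((m - w) + w * (1 - t)).
      by ring.
    apply: addr_ge0; first by rewrite mulr_ge0// ltW.
    apply: mulr_ge0; first exact: ltW.
    apply: addr_ge0; first by rewrite subr_ge0.
    by rewrite mulr_ge0// subr_ge0.
  - move=> t t01; rewrite /g /f.
    apply: cvgD; last by apply: cvgMl_tmp; exact: continuous_beta_majorant.
    have cw := continuous_beta_weight (a := a) (b := b) t01.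
    by apply: cvgB; apply: cvgMl_tmp => //; apply: cvgM.
  - move=> t t01; have := is_derive_primitive a0 b0 t01 => d3.
    move: t01; rewrite in_itv /= => /andP[t0 t1].
    have d1 := is_derive1_powR a t0; have d2 := is_derive_powR_onem b t1.
    apply: is_derive_eq.
    rewrite /g /f /GRing.scale /= /beta_weight.
    rewrite -(mulr_powRB1 (ltW t0) a0) -(@mulr_powRB1 _ (1 - t) b) ?subr_ge0 ?ltW//.
    rewrite /c; ring.
  - apply: cvgD; last by apply: cvgMl_tmp; exact: primitive0.
    rewrite -[X in _ --> X](mul0r 1); apply: cvgM; first exact: powR_cvg0.
    exact: powR_onem_cvg_right0.
  - apply: cvgD; last by apply: cvgMl_tmp; exact: primitive1.
    rewrite -[X in _ --> X](mulr0 1); apply: cvgM; first exact: powR_cvg_left1.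
    exact: powR_onem_cvg_left1.
have iw := integrable_beta_weight a0 b0.
have iwt : mu.-integrable I01 (EFin \o beta_weight (a + 1) b).
  by apply: integrable_beta_weight => //; rewrite addr_gt0.
have im := integrable_beta_majorant a0 b0.
have : \int[mu]_(t in I01) ((a * beta_weight a b t
    - c * beta_weight (a + 1) b t) + c * beta_majorant a b t)
    = c * (a^-1 + b^-1).
  transitivity (\int[mu]_(t in I01) g t); last by rewrite /Rintegral Ig.
  apply: eq_Rintegral => t; rewrite inE /= in_itv /= => /andP[t0 _].
  by rewrite /g /f beta_weightSl.
rewrite RintegralD//; last 2 first.
- have i1 := integrable_EFinZl a mI iw.
  have i2 := integrable_EFinZl c mI iwt.
  exact: (integrableB mI i1 i2).
- exact: integrable_EFinZl.
rewrite RintegralB//; [|exact: integrable_EFinZl|exact: integrable_EFinZl].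
rewrite !RintegralZl//.
rewrite [in X in _ + c * X]/Rintegral integral_beta_majorant//=.
rewrite /euler_beta -[X in a * X]/(\int[mu]_(t in I01) beta_weight a b t).
move=> H; apply/esym/eqP; rewrite -subr_eq0; apply/eqP.
exact: (addIr _ (etrans H (esym (add0r _)))).
Qed.

(** If the integral were 0, the nonnegative weight would vanish almost everywhere, yet it is
    positive on the open interval, which has measure 1. This permits division by the normalising
    factor of the Beta operator. *)
Lemma euler_beta_neq0 a b : 0 < a -> 0 < b -> euler_beta a b != 0.
Proof.
move=> a0 b0; apply/eqP => E0.
have iw := integrable_beta_weight a0 b0.
have mw : measurable_fun I01 (EFin \o beta_weight a b).
  by apply/measurable_EFinP; exact: measurable_beta_weight.
have I0 : (\int[mu]_(t in I01) `|(EFin \o beta_weight a b) t| = 0)%E.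
  under eq_integral => t _ do rewrite /= ger0_norm ?beta_weight_ge0//.
  have /fineK <- := integrable_fin_num mI iw.
  by congr EFin; exact: E0.
move/(ae_eq_integral_abs mu mI mw) : I0 => [N [mN N0 sub]].
have : (mu `]0%R, 1%R[%classic <= mu N)%E.
  apply: le_measure; rewrite ?inE//.
  move=> t t01; apply: sub => /= /(_ (subset_itv_oo_cc t01)) [].
  move: t01; rewrite /= in_itv /= => /andP[t0 t1] /eqP.
  by rewrite mulf_eq0 !gt_eqF// powR_gt0// subr_gt0.
by rewrite N0 lebesgue_measure_itv /= lte01 oppr0 adde0 leNgt lte01.
Qed.
End euler_beta.

(** * Triangular operators on polynomials *)

Section triangular.
Variable K : fieldType.
Implicit Types (p q : {poly K}) (e : nat -> {poly K}).

Lemma size_poly_pred p m : (size p <= m.+1)%N -> p`_m = 0 -> (size p <= m)%N.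
Proof.
move=> sp pm; apply/leq_sizeP => i; rewrite leq_eqVlt => /predU1P[<-//|mi].
exact: (leq_sizeP _ _ sp).
Qed.

(** The linear extension of X^j -> e_j; it serves for operators ([V] the polynomials) and for
    functionals given by moments ([V] the scalars). *)
Definition poly_extend (V : lmodType K) (e : nat -> V) p : V :=
  \sum_(j < size p) p`_j *: e j.

Lemma poly_extend_wide (V : lmodType K) (e : nat -> V) p m : (size p <= m)%N ->
  poly_extend e p = \sum_(j < m) p`_j *: e j.
Proof.
move=> sp; rewrite /poly_extend (big_ord_widen m (fun j => p`_j *: e j) sp).
rewrite big_mkcond /=; apply: eq_bigr => j _.
by case: ltnP => // h; rewrite nth_default// scale0r.
Qed.

Lemma poly_extend_is_linear (V : lmodType K) (e : nat -> V) :
  linear (poly_extend e).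
Proof.
move=> a p q; pose m := maxn (size p) (size q).
have sm : (size (a *: p + q)%R <= m)%N.
  rewrite (leq_trans (size_polyD _ _))// geq_max leq_max leq_maxr andbT.
  by rewrite size_scale_leq.
rewrite !(@poly_extend_wide _ _ _ m) ?leq_maxl ?leq_maxr//.
rewrite scaler_sumr -big_split; apply: eq_bigr => j _ /=.
by rewrite coefD coefZ scalerDl scalerA.
Qed.

HB.instance Definition _ (V : lmodType K) (e : nat -> V) :=
  GRing.isLinear.Build K {poly K} V *:%R (poly_extend e) (poly_extend_is_linear e).

Lemma poly_extendXn (V : lmodType K) (e : nat -> V) j : poly_extend e 'X^j = e j.
Proof.
rewrite /poly_extend size_polyXn big_ord_recr /= big1 ?add0r.
  by rewrite coefXn eqxx scale1r.
by move=> i _; rewrite coefXn ltn_eqF// scale0r.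
Qed.

(** [d j] is the diagonal entry in degree j. Reading the coefficient at j for every p of degree at
    most j, rather than a leading coefficient, avoids cases on the exact degree. *)
Definition triangular (d : nat -> K) (A : {poly K} -> {poly K}) :=
  forall p j, (size p <= j.+1)%N ->
    (size (A p) <= j.+1)%N /\ (A p)`_j = d j * p`_j.

(** A polynomial of degree at most j is a multiple of [e j] plus one of lower degree, so induction
    on the size reduces everything to the basis [e]. *)
Lemma triangularP (A : {linear {poly K} -> {poly K}}) d e :
  (forall j, size (e j) = j.+1) -> (forall j, (size (A (e j)) <= j.+1)%N) ->
  (forall j, (A (e j))`_j = d j * (e j)`_j) -> triangular d A.
Proof.
move=> se sA dA.
have e0 j : (e j)`_j != 0.
  have := lead_coef_eq0 (e j); rewrite /lead_coef se /= => ->.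
  by rewrite -size_poly_eq0 se.
have dec p j : (size p <= j.+1)%N ->
    exists c (r : {poly K}),
      [/\ (size r <= j)%N, p = c *: e j + r & p`_j = c * (e j)`_j].
  move=> sp; pose c := p`_j / (e j)`_j.
  exists c, (p - c *: e j); split; last by rewrite /c divfK.
  - apply: size_poly_pred; last by rewrite coefB coefZ divfK// subrr.
    rewrite (leq_trans (size_polyD _ _))// geq_max sp size_polyN.
    by rewrite (leq_trans (size_scale_leq _ _))// se.
  - by rewrite addrC subrK.
have sizeA m p : (size p <= m)%N -> (size (A p) <= m)%N.
  elim: m p => [p|m IH p /dec[c [r [sr -> _]]]].
    by rewrite leqn0 size_poly_eq0 => /eqP ->; rewrite linear0 size_poly0.
  rewrite linearP (leq_trans (size_polyD _ _))// geq_max.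
  rewrite (leq_trans (size_scale_leq _ _))//=.
  by rewrite ltnW// ltnS IH.
move=> p j sp; split; first exact: sizeA.
have [c [r [sr -> ->]]] := dec _ _ sp.
rewrite linearP coefD coefZ dA (nth_default _ (sizeA _ _ sr)).
ring.
Qed.

Lemma triangular_comp d1 d2 A1 A2 : triangular d1 A1 -> triangular d2 A2 ->
  triangular (fun j => d1 j * d2 j) (A1 \o A2).
Proof.
move=> t1 t2 p j /t2[s2 c2]; have [s1 c1] := t1 _ _ s2.
by split=> //=; rewrite c1 c2 mulrA.
Qed.

(** Back substitution: a monomial [p0] matches the top coefficient of q, and the remainder has lower
    degree. *)
Lemma triangular_surj (A : {linear {poly K} -> {poly K}}) d :
  triangular d A -> (forall j, d j != 0) ->
  forall m q, (size q <= m)%N -> exists2 p : {poly K}, (size p <= m)%N & A p = q.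
Proof.
move=> tA d0; elim=> [q|m IH q sq].
  rewrite leqn0 size_poly_eq0 => /eqP ->.
  by exists 0; rewrite ?size_poly0 ?linear0.
pose p0 : {poly K} := (q`_m / d m) *: 'X^m.
have sp0 : (size p0 <= m.+1)%N.
  by rewrite (leq_trans (size_scale_leq _ _))// size_polyXn.
have [sA cA] := tA _ _ sp0.
have [] := IH (q - A p0).
  apply: size_poly_pred.
    by rewrite (leq_trans (size_polyD _ _))// geq_max sq size_polyN.
  rewrite coefB cA /p0 coefZ coefXn eqxx mulr1 mulrC divfK// subrr//.
move=> p sp Ap; exists (p0 + p).
  by rewrite (leq_trans (size_polyD _ _))// geq_max sp0 ltnW.
by rewrite linearD Ap addrC subrK.
Qed.

(** A common form for the falling factorials nx(nx-1)... and the rising factorials nx(nx+1)..., with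
    c = n and s i = -i or i. *)
Definition affine_prod (c : K) (s : nat -> K) j : {poly K} :=
  \prod_(i < j) (c *: 'X + (s i)%:P).

Lemma affine_prodS c s j :
  affine_prod c s j.+1 = affine_prod c s j * (c *: 'X + (s j)%:P).
Proof. by rewrite /affine_prod big_ord_recr. Qed.

Lemma affine_prod_lead c s j : c != 0 ->
  size (affine_prod c s j) = j.+1 /\ (affine_prod c s j)`_j = c ^+ j.
Proof.
move=> c0; suff [sj lj] : size (affine_prod c s j) = j.+1 /\
    lead_coef (affine_prod c s j) = c ^+ j.
  by split=> //; rewrite -lj /lead_coef sj.
elim: j => [|j [sj lj]].
  by rewrite /affine_prod big_ord0 size_poly1 lead_coef1 expr0.
have sl : size (c *: 'X + (s j)%:P) = 2%N.
  by rewrite size_polyDl size_scale// ?size_polyX// size_polyC; case: (s j == 0).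
rewrite affine_prodS size_mul -?size_poly_eq0 ?sj ?sl//; split; first by rewrite addn2.
rewrite lead_coefM lj exprSr; congr (_ * _).
by rewrite /lead_coef sl coefD coefZ coefX coefC mulr1 addr0.
Qed.
End triangular.

(** * The Bernstein operator *)

Section bernstein_operator.
Variables (R : realType) (n : nat).
Hypothesis n_gt0 : (0 < n)%N.
Implicit Types p q : {poly R}.

Let n_neq0 : n%:R != 0 :> R. Proof. by rewrite pnatr_eq0 -lt0n. Qed.

Definition bernstein_poly p : {poly R} := bernstein n (horner p).

Lemma bernstein_poly_is_linear : linear bernstein_poly.
Proof.
move=> a p q; rewrite /bernstein_poly /bernstein scaler_sumr -big_split.
apply: eq_bigr => k _ /=; rewrite scalerA -scalerDl; congr (_ *: _).
by rewrite hornerD hornerZ; ring.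
Qed.

HB.instance Definition _ :=
  GRing.isLinear.Build R {poly R} {poly R} *:%R bernstein_poly
    bernstein_poly_is_linear.

Definition falling_poly j := affine_prod n%:R (fun i => - i%:R : R) j.

Lemma falling_polyE j k : (falling_poly j).[k%:R / n%:R] = (k ^_ j)%:R.
Proof.
elim: j => [|j IH].
  by rewrite /falling_poly /affine_prod big_ord0 hornerC ffactn0.
rewrite /falling_poly affine_prodS hornerM -/(falling_poly j) IH.
have -> : (n%:R *: 'X + (- j%:R)%:P).[k%:R / n%:R] = k%:R - j%:R :> R.
  by rewrite hornerD hornerZ hornerX hornerC mulrC divfK.
rewrite ffactnSr natrM.
have [kj|jk] := ltnP k j; first by rewrite ffact_small// !mul0r.
by rewrite natrB.
Qed.

(** Multiplied by k! (m-k-j)!, both sides become m!. *)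
Lemma bin_ffact_sub k j m : (k + j <= m)%N ->
  ((k + j) ^_ j * 'C(m, k + j) = m ^_ j * 'C(m - j, k))%N.
Proof.
move=> kjm.
have f0 : (0 < k`! * (m - (k + j))`!)%N by rewrite muln_gt0 !fact_gt0.
apply/eqP; rewrite -(eqn_pmul2r f0); apply/eqP.
have jm : (j <= m)%N by lia.
have -> : ((k + j) ^_ j * 'C(m, k + j) * (k`! * (m - (k + j))`!) =
    'C(m, k + j) * (((k + j) ^_ j * k`!) * (m - (k + j))`!))%N by nia.
have -> : (m ^_ j * 'C(m - j, k) * (k`! * (m - (k + j))`!) =
    m ^_ j * ('C(m - j, k) * (k`! * (m - j - k)`!)))%N.
  by rewrite -subnDA (addnC j k); nia.
rewrite bin_fact ?ffact_fact//; last by lia.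
have := @ffact_fact (k + j) j (leq_addl _ _); rewrite addnK => ->.
by rewrite bin_fact.
Qed.

(** At the node k/n the falling factorial is k(k-1)...(k-j+1), so the terms with k < j vanish; after
    the shift k -> k+j and [bin_ffact_sub], what is left is a full binomial expansion. *)
Lemma bernstein_falling_poly j :
  bernstein_poly (falling_poly j) = (n ^_ j)%:R *: 'X^j.
Proof.
rewrite /bernstein_poly /bernstein.
under eq_bigr do rewrite falling_polyE -natrM.
have [nj|jn] := ltnP n j.
  rewrite ffact_small// scale0r big1// => k _.
  by rewrite ffact_small ?mul0n ?scale0r// (leq_ltn_trans _ nj)// -ltnS.
rewrite -(big_mkord xpredT (fun k => (k ^_ j * 'C(n, k))%:R *:
  ('X ^+ k * (1 - 'X) ^+ (n - k)))).
rewrite (big_cat_nat (n := j)) ?leqW//= big1_seq ?add0r; last first.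
  move=> k /andP[_]; rewrite mem_index_iota => /andP[_ kj].
  by rewrite ffact_small// mul0n scale0r.
rewrite -{1}(add0n j) big_addn big_mkord subSn//.
(* Insert 1 = ((1-X)+X)^(n-j), whose expansion matches the sum term by term. *)
have -> : (n ^_ j)%:R *: 'X^j =
    (n ^_ j)%:R *: ('X^j * ((1 - 'X) + 'X) ^+ (n - j)) :> {poly R}.
  by rewrite subrK expr1n mulr1.
rewrite exprDn mulr_sumr scaler_sumr; apply: eq_bigr => k _.
rewrite bin_ffact_sub; last by have := ltn_ord k; lia.
rewrite natrM -scalerA; congr (_ *: _).
rewrite scaler_nat mulrnAr; congr (_ *+ _).
rewrite exprD subnDA [(n - k - j)%N]subnAC; ring.
Qed.

Lemma bernstein_triangular :
  triangular (fun j => (n ^_ j)%:R / n%:R ^+ j) bernstein_poly.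
Proof.
have L j := affine_prod_lead (fun i => - i%:R : R) j n_neq0.
apply: (@triangularP _ _ _ falling_poly) => j.
- by have [] := L j.
- rewrite /= bernstein_falling_poly (leq_trans (size_scale_leq _ _))//.
  by rewrite size_polyXn.
- rewrite /= bernstein_falling_poly coefZ coefXn eqxx mulr1.
  by have [_ ->] := L j; rewrite divfK// expf_neq0.
Qed.

Lemma bernstein_poly1 : bernstein_poly 1 = 1.
Proof.
have := bernstein_falling_poly 0.
by rewrite /falling_poly /affine_prod big_ord0 ffactn0 scale1r.
Qed.

Lemma bernstein_polyX : bernstein_poly 'X = 'X.
Proof.
have := bernstein_falling_poly 1.
rewrite /falling_poly /affine_prod big_ord1 ffactn1 oppr0 addr0 linearZ.
by move/(scalerI n_neq0).
Qed.

Lemma eq_bernstein (f g : R -> R) :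
  (forall k, (k <= n)%N -> f (k%:R / n%:R) = g (k%:R / n%:R)) ->
  bernstein n f = bernstein n g.
Proof. by move=> fg; apply: eq_bigr => k _; rewrite fg// -ltnS. Qed.

Lemma size_bernstein (f : R -> R) : (size (bernstein n f) <= n.+1)%N.
Proof.
apply: (leq_trans (size_sum _ _ _)); apply/bigmax_leqP => k _.
rewrite (leq_trans (size_scale_leq _ _))//.
rewrite (leq_trans (size_polyMleq _ _))// size_polyXn /=.
have -> : 1 - 'X = - ('X - 1%:P) :> {poly R} by rewrite opprB.
rewrite exprNn -signr_odd.
case: (odd _); rewrite ?expr1 ?expr0 ?mulN1r ?mul1r ?size_polyN.
  by rewrite size_exp_XsubC; have := ltn_ord k; lia.
by rewrite size_exp_XsubC; have := ltn_ord k; lia.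
Qed.

Lemma bernstein0 (f : R -> R) : (bernstein n f).[0] = f 0.
Proof.
rewrite /bernstein horner_sum big_ord_recl /= big1 ?addr0.
  by rewrite !hornerE /= bin0 subr0 expr1n !mulr1.
by move=> k _; rewrite !hornerE /= expr0n mulr0 mul0r.
Qed.

Lemma bernstein1 (f : R -> R) : (bernstein n f).[1] = f 1.
Proof.
rewrite /bernstein horner_sum big_ord_recr /= big1 ?add0r.
  by rewrite !hornerE /= binn divff// subnn expr0 expr1n !mulr1.
move=> k _; rewrite !hornerE /= subrr expr0n subn_eq0 leqNgt ltn_ord /=.
by rewrite mulr0.
Qed.
End bernstein_operator.

(** * The genuine Beta operator on polynomials *)

(** Used for two weights: the Beta weight, and the constant 1 to make [poly_int01] linear. *)
Lemma Rintegral_horner (R : realType)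
    (mu : {measure set (measurableTypeR R) -> \bar R})
    (D : set (measurableTypeR R)) (w : R -> R) (p : {poly R}) :
  measurable D ->
  (forall j, mu.-integrable D (EFin \o (fun t => w t * t ^+ j))) ->
  \int[mu]_(t in D) (w t * p.[t]) =
  poly_extend (fun j => \int[mu]_(t in D) (w t * t ^+ j) : R^o) p.
Proof.
move=> mD iw; rewrite /poly_extend.
pose s m t := \sum_(j < m) p`_j * (w t * t ^+ j).
have is_ m : mu.-integrable D (EFin \o s m).
  elim: m => [|m IH].
    rewrite (_ : s 0%N = cst 0); last first.
    by apply/funext => t; rewrite /s big_ord0.
    exact: integrable0.
  have -> : s m.+1 = (fun t => s m t + p`_m * (w t * t ^+ m)).
    by apply/funext => t; rewrite /s big_ord_recr.
  exact: (integrableD mD IH (integrable_EFinZl p`_m mD (iw m))).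
transitivity (\int[mu]_(t in D) s (size p) t).
  apply: eq_Rintegral => t _; rewrite horner_coef mulr_sumr.
  by apply: eq_bigr => j _; ring.
elim: (size p) => [|m IH].
  rewrite big_ord0; transitivity (0 * fine (mu D)); last exact: mul0r.
  by rewrite -Rintegral_cst//; apply: eq_Rintegral => t _; rewrite /s big_ord0.
rewrite big_ord_recr -IH /= /GRing.scale /= -RintegralZl//.
rewrite -RintegralD//; last exact: integrable_EFinZl.
by apply: eq_Rintegral => t _; rewrite /s big_ord_recr.
Qed.

Section beta_operator.
Variables (R : realType).
Implicit Types (a b : R) (p q : {poly R}).
Local Notation mu := (@lebesgue_measure R).
Local Notation I01 := (`[(0 : R)%R, (1 : R)%R]%classic).

Lemma euler_beta_addn a b j : 0 < a -> 0 < b ->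
  euler_beta (a + j%:R) b * \prod_(i < j) (a + b + i%:R) =
  euler_beta a b * \prod_(i < j) (a + i%:R).
Proof.
move=> a0 b0; elim: j => [|j IH]; first by rewrite !big_ord0 addr0.
have aj0 : 0 < a + j%:R by rewrite ltr_wpDr.
rewrite !big_ord_recr /= [RHS]mulrA -IH -natr1 addrA.
have := euler_betaS aj0 b0; set P := \prod_(i < j) _.
rewrite (addrAC a j%:R b) => E.
by rewrite mulrCA [X in _ * X]mulrC E; ring.
Qed.

Lemma beta_weight_addn a b t j : 0 < a -> 0 <= t ->
  beta_weight (a + j%:R) b t = beta_weight a b t * t ^+ j.
Proof.
move=> a0 t0; elim: j => [|j IH]; first by rewrite addr0 expr0 mulr1.
rewrite -natr1 addrA beta_weightSl//; last by rewrite ltr_wpDr.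
by rewrite IH exprSr mulrA.
Qed.

Let mI : measurable (I01 : set (measurableTypeR R)).
Proof. exact: measurable_itv. Qed.

Lemma Rintegral_beta_weight_horner a b p : 0 < a -> 0 < b ->
  \int[mu]_(t in I01) (beta_weight a b t * p.[t]) =
  poly_extend (fun j => euler_beta (a + j%:R) b : R^o) p.
Proof.
move=> a0 b0; rewrite Rintegral_horner//.
  apply: eq_bigr => j _; congr (_ *: _); apply: eq_Rintegral => t.
  rewrite inE /= in_itv /= => /andP[t0 _].
  by rewrite -beta_weight_addn.
move=> j; have aj0 : 0 < a + j%:R by rewrite ltr_wpDr.
apply: eq_integrable (integrable_beta_weight aj0 b0) => //.
move=> t; rewrite inE /= in_itv /= => /andP[t0 _].
by rewrite /= beta_weight_addn.
Qed.

Variable n : nat.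
Hypothesis n_gt0 : (0 < n)%N.

Let n_neq0 : n%:R != 0 :> R. Proof. by rewrite pnatr_eq0 -lt0n. Qed.

Definition rising_const j : R := \prod_(i < j) (n + i)%:R.

Lemma rising_const_neq0 j : rising_const j != 0.
Proof.
apply/prodf_neq0 => i _.
by rewrite pnatr_eq0 -lt0n addn_gt0 n_gt0.
Qed.

(** The image of t^j under the Beta operator, namely the quotient B(nx+j, n(1-x)) / B(nx,
    n(1-x)). *)
Definition rising_poly j : {poly R} :=
  (rising_const j)^-1 *: affine_prod n%:R (fun i => i%:R : R) j.

Lemma horner_affine_prod c (s : nat -> R) j x :
  (affine_prod c s j).[x] = \prod_(i < j) (c * x + s i).
Proof.
rewrite /affine_prod horner_prod; apply: eq_bigr => i _.
by rewrite hornerD hornerZ hornerX hornerC.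
Qed.

Definition beta_op : {poly R} -> {poly R} := poly_extend rising_poly.

HB.instance Definition _ := GRing.Linear.on beta_op.

Lemma horner_beta_op p x :
  (beta_op p).[x] = poly_extend (fun j => (rising_poly j).[x] : R^o) p.
Proof.
rewrite /beta_op /poly_extend horner_sum.
by apply: eq_bigr => j _; rewrite hornerZ.
Qed.

Lemma rising_poly_horner0 j : (rising_poly j).[0] = (j == 0%N)%:R.
Proof.
rewrite hornerZ horner_affine_prod /rising_const; case: j => [|j].
  by rewrite !big_ord0 invr1 mulr1.
by rewrite [X in _ * X]big_ord_recl /= mulr0 addr0 mul0r mulr0.
Qed.

Lemma rising_poly_horner1 j : (rising_poly j).[1] = 1.
Proof.
rewrite hornerZ horner_affine_prod /rising_const mulr1.
under [X in _ * X]eq_bigr do rewrite -natrD.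
by rewrite mulVf// rising_const_neq0.
Qed.

(** Links the integral operator to its algebraic model [beta_op]. Inside the interval both Beta
    parameters are positive and the iterated recurrence gives the moments; the endpoints compare
    with the values of [rising_poly] at 0 and 1. *)
Lemma genuine_beta_horner p x : x \in `[0, 1] ->
  genuine_beta n (horner p) x = (beta_op p).[x].
Proof.
rewrite in_itv /= => /andP[x0 x1]; rewrite horner_beta_op /genuine_beta.
case: eqVneq => [->|xN0].
  rewrite horner_coef; apply: eq_bigr => j _.
  by rewrite rising_poly_horner0 expr0n.
case: eqVneq => [->|xN1].
  rewrite horner_coef; apply: eq_bigr => j _.
  by rewrite rising_poly_horner1 expr1n.
have a0 : 0 < n%:R * x by rewrite mulr_gt0 ?ltr0n// lt_neqAle eq_sym xN0.
have b0 : 0 < n%:R * (1 - x).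
  by rewrite mulr_gt0 ?ltr0n// subr_gt0 lt_neqAle xN1.
have B0 := euler_beta_neq0 a0 b0.
rewrite [X in _ * X](Rintegral_beta_weight_horner p a0 b0).
rewrite /poly_extend mulr_sumr; apply: eq_bigr => j _.
rewrite /GRing.scale /= mulrCA; congr (_ * _).
have := euler_beta_addn j a0 b0.
(* The two parameters add up to n, so the denominator is free of x and equals [rising_const j]. *)
under eq_bigr do rewrite -mulrDr [x + _]addrC subrK mulr1 -natrD.
rewrite -/(rising_const j) hornerZ horner_affine_prod.
move=> /(canRL (mulfK (rising_const_neq0 j))) ->.
by field; rewrite B0 rising_const_neq0.
Qed.

Lemma beta_op_triangular :
  triangular (fun j => n%:R ^+ j / rising_const j) beta_op.
Proof.
have L j := affine_prod_lead (fun i => i%:R : R) j n_neq0.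
apply: (@triangularP _ _ _ (fun j => 'X^j)) => j.
- by rewrite size_polyXn.
- rewrite /= /beta_op poly_extendXn (leq_trans (size_scale_leq _ _))//.
  by have [-> _] := L j.
- rewrite /= /beta_op poly_extendXn coefZ coefXn eqxx mulr1 mulrC.
  by have [_ ->] := L j.
Qed.

Lemma beta_op1 : beta_op 1 = 1.
Proof.
rewrite -(expr0 'X) /beta_op poly_extendXn /rising_poly /rising_const.
by rewrite /affine_prod !big_ord0 invr1 scale1r.
Qed.

Lemma beta_opX : beta_op 'X = 'X.
Proof.
rewrite -[X in beta_op X]expr1 /beta_op poly_extendXn /rising_poly.
rewrite /rising_const /affine_prod !big_ord1 addn0 addr0 scalerA mulVf//.
by rewrite scale1r.
Qed.

Lemma beta_op_surj m q : (size q <= m)%N ->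
  exists2 p : {poly R}, (size p <= m)%N & beta_op p = q.
Proof.
apply: (triangular_surj beta_op_triangular) => j.
by rewrite mulf_neq0 ?invr_eq0 ?expf_neq0 ?rising_const_neq0.
Qed.

(** Surjectivity on polynomials of degree at most n makes the set inside [xget] inhabited, which
    rules out the default value. *)
Lemma FopP (f : R -> R) : (size (Fop n f) <= n.+1)%N /\
  forall x, x \in `[0, 1] -> (beta_op (Fop n f)).[x] = (bernstein n f).[x].
Proof.
have [p sp Vp] := beta_op_surj (size_bernstein n_gt0 f).
rewrite /Fop /genuine_beta_inv; case: xgetP => [q _ [sq Hq]|].
  by split=> // x x01; rewrite -genuine_beta_horner// Hq.
move=> /(_ p); case; split=> // x x01.
by rewrite genuine_beta_horner// Vp.
Qed.
End beta_operator.

(** * Symmetry and the Jacobi polynomials *)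

Section poly_integral.
Variable R : realType.
Implicit Types (p q : {poly R}).
Local Notation mu := (@lebesgue_measure R).
Local Notation I01 := (`[(0 : R)%R, (1 : R)%R]%classic).

(** The codomain [R^o] is R as a module over itself, so that the integral can be declared linear. *)
Definition poly_int01 p : R^o := \int[mu]_(t in I01) p.[t].

Lemma poly_int01_is_linear : linear poly_int01.
Proof.
have E p : poly_int01 p =
    poly_extend (fun j => \int[mu]_(t in I01) (1 * t ^+ j) : R^o) p.
  rewrite -(Rintegral_horner (w := fun=> 1)).
  - by apply: eq_Rintegral => t _; rewrite mul1r.
  - exact: measurable_itv.
  move=> j; apply: continuous_compact_integrable; first exact: segment_compact.
  apply: continuous_subspaceT => t.
  by apply: cvgM; [exact: cvg_cst|exact: exprn_continuous].
by move=> a p q; rewrite !E linearP.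
Qed.

HB.instance Definition _ :=
  GRing.isLinear.Build R {poly R} R^o *:%R poly_int01 poly_int01_is_linear.

Definition jacobi_weight : {poly R} := 'X * (1 - 'X).

Definition jacobi_form p q : R := poly_int01 (p * q * jacobi_weight).

Lemma jacobi_formC p q : jacobi_form p q = jacobi_form q p.
Proof. by rewrite /jacobi_form (mulrC p). Qed.

Lemma jacobi_form_suml I (r : seq I) (c : I -> R) (e : I -> {poly R}) q :
  jacobi_form (\sum_(i <- r) c i *: e i) q =
  \sum_(i <- r) c i * jacobi_form (e i) q.
Proof.
rewrite /jacobi_form !mulr_suml linear_sum; apply: eq_bigr => i _.
by rewrite -!scalerAl linearZ.
Qed.

Lemma size_jacobi_weight : size jacobi_weight = 3%N.
Proof.
have -> : jacobi_weight = - ('X * ('X - 1%:P)) by rewrite /jacobi_weight; ring.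
by rewrite size_polyN size_mul ?polyX_eq0 ?polyXsubC_eq0// size_polyX size_XsubC.
Qed.

Lemma jacobi_weight_neq0 : jacobi_weight != 0.
Proof. by rewrite -size_poly_eq0 size_jacobi_weight. Qed.

Lemma size_mul_jacobi_weight p m :
  (size (jacobi_weight * p)%R <= m.+2)%N = (size p <= m)%N.
Proof.
have [->|p0] := eqVneq p 0; first by rewrite mulr0 size_poly0.
by rewrite size_mul ?jacobi_weight_neq0// size_jacobi_weight.
Qed.

(** The weight has degree 2 and leading coefficient -1. *)
Lemma coef_mul_jacobi_weight p m : (size p <= m.+1)%N ->
  (jacobi_weight * p)`_m.+2 = - p`_m.
Proof.
move=> sp; have -> : jacobi_weight * p = 'X * p - 'X * ('X * p).
  by rewrite /jacobi_weight; ring.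
by rewrite coefB !coefXM /= nth_default// sub0r.
Qed.

Lemma jacobi_weight_factor p : p.[0] = 0 -> p.[1] = 0 ->
  exists q, p = jacobi_weight * q.
Proof.
move=> p0 p1; have /factor_theorem[q pq] : root p 0 by apply/rootP.
have /factor_theorem[r qr] : root q 1.
  by apply/rootP; move: p1; rewrite pq !hornerE => H; lra.
exists (- r); rewrite pq qr /jacobi_weight subr0 -polyC1; ring.
Qed.

(** * Expansion in the Jacobi polynomials *)

Section orthonormal.
Variable J : nat -> {poly R}.
Hypothesis size_J : forall i, size (J i) = i.+1.
Hypothesis orthonormal_J : forall i j, jacobi_form (J i) (J j) = (i == j)%:R.

(** One J_i in each degree gives some expansion, by cancelling top coefficients; orthonormality then
    identifies its coefficients. *)
Lemma jacobi_expansion p m : (size p <= m)%N ->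
  p = \sum_(i < m) jacobi_form p (J i) *: J i.
Proof.
move=> sp; have [c pc] : exists c : nat -> R, p = \sum_(i < m) c i *: J i.
  elim: m p sp => [|m IH] p.
    rewrite leqn0 size_poly_eq0 => /eqP ->; exists (fun=> 0).
    by rewrite big_ord0.
  move=> sp; pose a := p`_m / (J m)`_m.
  have J0 : (J m)`_m != 0.
    have := lead_coef_eq0 (J m); rewrite /lead_coef size_J /= => ->.
    by rewrite -size_poly_eq0 size_J.
  have [|c Hc] := IH (p - a *: J m).
    apply: size_poly_pred; last by rewrite coefB coefZ divfK// subrr.
    rewrite (leq_trans (size_polyD _ _))// geq_max sp size_polyN.
    by rewrite (leq_trans (size_scale_leq _ _))// size_J.
  exists (fun i => if (i == m)%N then a else c i).
  rewrite big_ord_recr /= eqxx; apply/eqP; rewrite -subr_eq Hc; apply/eqP.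
  by apply: eq_bigr => i _; rewrite ltn_eqF.
rewrite {1}pc; apply: eq_bigr => i _; congr (_ *: _).
rewrite pc jacobi_form_suml (bigD1 i)//= orthonormal_J eqxx mulr1 big1 ?addr0//.
by move=> k ki; rewrite orthonormal_J (negbTE (_ : (k : nat) != i)) ?mulr0.
Qed.

(* A symmetric operator preserving every degree has each J_i as an
   eigenvector: T J_i is orthogonal to J_l for l < i because T J_l has degree
   at most l. *)
Lemma jacobi_eigen (T : {poly R} -> {poly R}) d : triangular d T ->
  (forall p q, jacobi_form (T p) q = jacobi_form p (T q)) ->
  forall i, T (J i) = d i *: J i.
Proof.
move=> tT symT i.
have [sT cT] : (size (T (J i)) <= i.+1)%N /\ (T (J i))`_i = d i * (J i)`_i.
  by apply: tT; rewrite size_J.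
have J0 : (J i)`_i != 0.
  have := lead_coef_eq0 (J i); rewrite /lead_coef size_J /= => ->.
  by rewrite -size_poly_eq0 size_J.
have E : T (J i) = jacobi_form (T (J i)) (J i) *: J i.
  rewrite {1}(jacobi_expansion sT) big_ord_recr /= big1 ?add0r// => l _.
  rewrite symT jacobi_formC.
  have [sl _] : (size (T (J l)) <= l.+1)%N /\ (T (J l))`_l = d l * (J l)`_l.
    by apply: tT; rewrite size_J.
  rewrite (jacobi_expansion sl) jacobi_form_suml big1 ?scale0r// => k _.
  by rewrite orthonormal_J ltn_eqF ?mulr0// (leq_trans (ltn_ord k)).
rewrite E; congr (_ *: _); apply: (mulIf J0).
by rewrite -cT {2}E coefZ.
Qed.
End orthonormal.

(** * The composite operator on multiples of x(1-x), with n = m+1 *)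

Section durrmeyer.
Variable m : nat.

(** The operator T of the introduction. The index j stands for the interior Bernstein node (j+1)/n,
    where the Beta parameters are j+1 and m-j; a factor x(1-x) is taken out of each basis
    polynomial. *)
Definition durrmeyer_op p : {poly R} :=
  \sum_(j < m) ('C(m.+1, j.+1)%:R * (euler_beta j.+1%:R (m - j)%:R)^-1 *
     poly_int01 ('X ^+ j.+1 * (1 - 'X) ^+ (m - j) * p)) *:
    ('X ^+ j * (1 - 'X) ^+ (m - j.+1)).

Lemma expr_subnS j : (j < m)%N ->
  (1 - 'X) ^+ (m - j) = (1 - 'X) * (1 - 'X) ^+ (m - j.+1) :> {poly R}.
Proof. by move=> jm; rewrite -exprS -subSn// subSS. Qed.

(** Pairing the jth basis polynomial with q restores the factor x(1-x) and yields the very moment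
    that appears in the coefficient, so each term is a constant times a moment of p times the same
    moment of q. *)
Lemma durrmeyer_op_sym p q :
  jacobi_form (durrmeyer_op p) q = jacobi_form p (durrmeyer_op q).
Proof.
rewrite [RHS]jacobi_formC !jacobi_form_suml; apply: eq_bigr => j _.
have E r : jacobi_form ('X ^+ j * (1 - 'X) ^+ (m - j.+1)) r =
    poly_int01 ('X ^+ j.+1 * (1 - 'X) ^+ (m - j) * r).
  rewrite /jacobi_form (expr_subnS (ltn_ord j)) /jacobi_weight exprS.
  congr poly_int01; ring.
by rewrite !E; ring.
Qed.

Lemma beta_op_jacobi_weight p j : (j < m)%N ->
  (beta_op m.+1 (jacobi_weight * p)).[j.+1%:R / m.+1%:R] =
  (euler_beta j.+1%:R (m - j)%:R)^-1 *
    poly_int01 ('X ^+ j.+1 * (1 - 'X) ^+ (m - j) * p).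
Proof.
move=> jm; set x := _ / _.
have n0 : m.+1%:R != 0 :> R by rewrite pnatr_eq0.
have nx : m.+1%:R * x = j.+1%:R by rewrite /x mulrC divfK.
have n1x : m.+1%:R * (1 - x) = (m - j)%:R.
  by rewrite mulrBr nx mulr1 -natrB ?subSS// ltnS ltnW.
have x0 : 0 < x by rewrite divr_gt0 ?ltr0n.
have x1 : x < 1 by rewrite ltr_pdivrMr ?ltr0n// mul1r ltr_nat ltnS.
rewrite -genuine_beta_horner//; last by rewrite in_itv /= !ltW.
rewrite /genuine_beta gt_eqF// lt_eqF// nx n1x; congr (_ * _).
apply: eq_Rintegral => t; rewrite inE /= in_itv /= => /andP[t0 t1].
have -> : j.+1%:R - 1 = j%:R :> R by rewrite -natr1 addrK.
have -> : (m - j)%:R - 1 = (m - j.+1)%:R :> R.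
  by rewrite -(natrB _ (n := 1%N)) ?subn_gt0// subn1 -subnS.
rewrite !powR_mulrn ?subr_ge0// expr_subnS// exprS /jacobi_weight.
by rewrite !hornerE /=; ring.
Qed.

(** The Beta operator keeps endpoint values, so the terms k = 0 and k = n of the Bernstein sum
    vanish; the others come from [beta_op_jacobi_weight]. *)
Lemma bernstein_beta_jacobi_weight p :
  bernstein_poly m.+1 (beta_op m.+1 (jacobi_weight * p)) =
  jacobi_weight * durrmeyer_op p.
Proof.
rewrite /bernstein_poly /bernstein big_ord_recl big_ord_recr /=.
have w0 : (jacobi_weight * p).[0] = 0 by rewrite !hornerE /=; ring.
have w1 : (jacobi_weight * p).[1] = 0 by rewrite !hornerE /=; ring.
have i0 : (0 : R) \in `[0, 1] by rewrite in_itv /= lexx ler01.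
have i1 : (1 : R) \in `[0, 1] by rewrite in_itv /= lexx ler01.
rewrite mul0r divff ?pnatr_eq0// -!genuine_beta_horner//.
rewrite /genuine_beta eqxx oner_eq0 eqxx w0 w1 !mul0r !scale0r add0r addr0.
rewrite /durrmeyer_op mulr_sumr; apply: eq_bigr => j _.
rewrite /bump /= add1n beta_op_jacobi_weight// -scalerAr.
congr (_ *: _); first by ring.
rewrite subSS (expr_subnS (ltn_ord j)) exprS /jacobi_weight; ring.
Qed.

(** The product of the diagonal entries of the Bernstein and Beta operators in degree k, after
    cancelling n^k. *)
Definition durrmeyer_eigenvalue k : R :=
  (m.+1 ^_ k)%:R / rising_const R m.+1 k.

(** Multiplication by the weight raises degrees by 2, hence the entry [i.+2]; the sign of its
    leading coefficient occurs on both sides and cancels. *)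
Lemma durrmeyer_op_triangular :
  triangular (fun i => durrmeyer_eigenvalue i.+2) durrmeyer_op.
Proof.
move=> p j sp.
have n0 : m.+1%:R != 0 :> R by rewrite pnatr_eq0.
have t := triangular_comp (@bernstein_triangular R _ (ltn0Sn m))
  (@beta_op_triangular R _ (ltn0Sn m)).
have [] := t (jacobi_weight * p) j.+2.
  by rewrite (size_mul_jacobi_weight p j.+1).
rewrite /= bernstein_beta_jacobi_weight size_mul_jacobi_weight => s c.
split=> //; move: c; rewrite !coef_mul_jacobi_weight// mulrN => /oppr_inj ->.
congr (_ * _); rewrite /durrmeyer_eigenvalue mulrA divfK ?expf_neq0//.
Qed.
(** The inverse eigenvalue is the factorial quotient of the final formula: the falling factorial is
    n!/(n-k)! and the rising one is (n+k-1)!/(n-1)!. *)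
Lemma durrmeyer_eigenvalueV k : (0 < k <= m.+1)%N ->
  (durrmeyer_eigenvalue k)^-1 =
  ((m.+1 - k)`! * (m.+1 + k - 1)`!)%:R / ((m.+1 - 1)`! * m.+1`!)%:R.
Proof.
move=> /andP[k0 km].
have rE : rising_const R m.+1 k * m`!%:R = (m + k)`!%:R.
  elim: k {k0 km} => [|k IH].
    by rewrite /rising_const big_ord0 mul1r addn0.
  rewrite /rising_const big_ord_recr /= -/(rising_const R m.+1 k) mulrAC IH.
  by rewrite -natrM mulnC addSn -factS addnS.
have fE : (m.+1 ^_ k)%:R * (m.+1 - k)`!%:R = m.+1`!%:R :> R.
  by rewrite -natrM ffact_fact.
have f0 j : j`!%:R != 0 :> R by rewrite pnatr_eq0 -lt0n fact_gt0.
rewrite /durrmeyer_eigenvalue invf_div addSn !subSS !subn0.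
rewrite (natrM _ (m.+1 - k)`!) (natrM _ m`!) -rE -fE.
have g0 : (m.+1 ^_ k)%:R != 0 :> R by rewrite pnatr_eq0 -lt0n ffact_gt0.
by field; rewrite !f0 g0.
Qed.
End durrmeyer.
End poly_integral.


(** * The expansion of F_n f *)

Unset Implicit Arguments.

Theorem mainTheorem14 (R : realType) (J : nat -> {poly R})
  (size_J : forall i : nat, size (J i) = i.+1)
  (orthonormal_J : forall i j : nat,
    \int[@lebesgue_measure R]_(t in `[0, 1])
      ((J i).[t] * (J j).[t] * (t * (1 - t))) = (i == j)%:R)
  (n : nat) (n_ge1 : (1 <= n)%N)
  (f : R -> R) (f_cont : {within `[0, 1], continuous f})
  (x : R) (x01 : x \in `[0, 1]) :
  (Fop n f).[x] =
    linterp f x +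
    \sum_(2 <= k < n.+1)
      x * (1 - x) * (J (k - 2)%N).[x] *
      (((n - k)`! * (n + k - 1)`!)%:R / ((n - 1)`! * n`!)%:R) *
      \int[@lebesgue_measure R]_(t in `[0, 1])
        (((bernstein n (horner (bernstein n f))).[t] - linterp f t) *
         (J (k - 2)%N).[t]).
Proof.
have orthoJ i j : jacobi_form (J i) (J j) = (i == j)%:R.
  rewrite -orthonormal_J; apply: eq_Rintegral => t _.
  by rewrite /jacobi_weight !hornerE /=.
case: n n_ge1 => [//|m] n0.
have [sF VF] := FopP n0 f.
pose L : {poly R} := f 0 *: (1 - 'X) + f 1 *: 'X.
have LE t : L.[t] = linterp f t by rewrite /linterp !hornerE /=; ring.
have i0 : (0 : R) \in `[0, 1] by rewrite in_itv /= lexx ler01.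
have i1 : (1 : R) \in `[0, 1] by rewrite in_itv /= lexx ler01.
(* Both operators keep endpoint values, so F_n f agrees with f at 0 and 1, and F_n f - Lf is the
   weight times some G of degree at most n-2. *)
have F0 : (Fop m.+1 f).[0] = f 0.
  have := VF 0 i0; rewrite -genuine_beta_horner// bernstein0//.
  by rewrite /genuine_beta eqxx.
have F1 : (Fop m.+1 f).[1] = f 1.
  have := VF 1 i1; rewrite -genuine_beta_horner// bernstein1//.
  by rewrite /genuine_beta oner_eq0 eqxx.
have [||G FG] := @jacobi_weight_factor R (Fop m.+1 f - L).
- by rewrite hornerD hornerN F0 LE /linterp; ring.
- by rewrite hornerD hornerN F1 LE /linterp; ring.
have sL : (size L <= 2)%N.
  rewrite (leq_trans (size_polyD _ _))// geq_max.
  rewrite !(leq_trans (size_scale_leq _ _)) ?size_polyX//.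
  rewrite (leq_trans (size_polyD _ _))// size_polyN size_polyX geq_max.
  by rewrite size_poly1.
have sG : (size G <= m)%N.
  rewrite -size_mul_jacobi_weight -FG (leq_trans (size_polyD _ _))//.
  by rewrite geq_max sF size_polyN (leq_trans sL).
have L1 : L = (f 1 - f 0) *: 'X + f 0 *: 1.
  by rewrite /L scalerBr scalerBl addrC -addrA [- _ + _]addrC.
have bL : beta_op m.+1 L = L.
  by rewrite L1 [LHS]linearP [X in _ + X]linearZ /= beta_op1 beta_opX.
have BL : bernstein_poly m.+1 L = L.
  rewrite L1 [LHS]linearP [X in _ + X]linearZ /= bernstein_poly1//.
  by rewrite bernstein_polyX.
have B2 : bernstein m.+1 (horner (bernstein m.+1 f)) =
    L + jacobi_weight R * durrmeyer_op m G.
  transitivity (bernstein_poly m.+1 (beta_op m.+1 (Fop m.+1 f))).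
    (* [VF] is known on [0,1] only, which contains all the nodes k/n. *)
    apply: eq_bernstein => k km; rewrite VF// in_itv /=.
    by rewrite divr_ge0//= ler_pdivrMr ?ltr0n// mul1r ler_nat.
  rewrite -[Fop _ _](subrK L) FG addrC (linearD (beta_op m.+1)) /= bL.
  rewrite (linearD (bernstein_poly m.+1)) /= BL.
  by rewrite bernstein_beta_jacobi_weight.
have eig := jacobi_eigen size_J orthoJ (durrmeyer_op_triangular m)
  (@durrmeyer_op_sym R m).
rewrite -[Fop _ _](subrK L) addrC hornerD LE FG; congr (_ + _).
(* Expand G in the J_i and compare termwise, with k = i+2. *)
rewrite hornerM {1}(jacobi_expansion size_J orthoJ sG) horner_sum mulr_sumr.
rewrite -[2%N]add0n big_addn subSS subn1 /= big_mkord.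
apply: eq_bigr => i _; rewrite addnK.
have -> : \int[@lebesgue_measure R]_(t in `[0, 1])
    (((bernstein m.+1 (horner (bernstein m.+1 f))).[t] - linterp f t) *
      (J i).[t]) = jacobi_form (durrmeyer_op m G) (J i).
  apply: eq_Rintegral => t _; rewrite B2 -LE.
  by rewrite hornerD addrC addKr !hornerM; ring.
(* Symmetry moves T onto J_i, so the integral is the eigenvalue times the ith Jacobi coefficient of
   G; the factorial quotient then cancels that eigenvalue. *)
rewrite durrmeyer_op_sym eig /=.
have -> : jacobi_form G (durrmeyer_eigenvalue R m i.+2 *: J i) =
    durrmeyer_eigenvalue R m i.+2 * jacobi_form G (J i).
  by rewrite /jacobi_form -scalerAr -scalerAl linearZ.
have kn : (0 < i + 2 <= m.+1)%N by have := ltn_ord i; lia.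
have := durrmeyer_eigenvalueV R kn; rewrite [(m.+1 - 1)%N]subn1 => <-.
rewrite addn2.
(* The bound k = i+2 <= n keeps the falling factorial nonzero. *)
have d0 : durrmeyer_eigenvalue R m i.+2 != 0.
  rewrite mulf_neq0 ?invr_eq0 ?rising_const_neq0// pnatr_eq0 -lt0n ffact_gt0.
  by have := ltn_ord i; lia.
move: (durrmeyer_eigenvalue _ _ _) d0 => d d0.
rewrite hornerZ /jacobi_weight !hornerE /=.
by field.
Qed.
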